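(* Suppose that $$\int_0^\infty g(\zeta)^{-1/m}\,\zeta^{1/m-1}\,d\zeta<\infty.$$ Then the inequality $\sum_{|\alpha|=m}\partial^\alpha a_\alpha(x,u)\ge g(|u|)$ in $\mathbb{R}^n$ has no global weak solutions.
   Context: Let $m,n\ge 1$ be integers. For each multi-index $\alpha=(\alpha_1,\dots,\alpha_n)$ with $|\alpha|=\alpha_1+\dots+\alpha_n=m$, let $a_\alpha:\mathbb{R}^n\times\mathbb{R}\to\mathbb{R}$ be a Caratheodory function (measurable in $x$ for every $\zeta$, continuous in $\zeta$ for almost every $x$) such that, for some constant $A>0$, $|a_\alpha(x,\zeta)|\le A|\zeta|$ for almost all $x\in\mathbb{R}^n$ and all $\zeta\in\mathbb{R}$. Here $\partial^\alpha=\partial^{|\alpha|}/(\partial_{x_1}^{\alpha_1}\cdots\partial_{x_n}^{\alpha_n})$. Let $g:[0,\infty)\to\mathbb{R}$ be a non-decreasing convex function with $g(\zeta)>0$ for all $\zeta>0$. A function $u\in L_{1,loc}(\mathbb{R}^n)$ (real-valued) is called a global weak solution of $\sum_{|\alpha|=m}\partial^\alpha a_\alpha(x,u)\ge g(|u|)$ in $\mathbb{R}^n$ if $g(|u|)\in L_{1,loc}(\mathbb{R}^n)$ and $$\int_{\mathbb{R}^n}\sum_{|\alpha|=m}(-1)^m a_\alpha(x,u)\,\partial^\alpha\varphi\,dx\ge\int_{\mathbb{R}^n}g(|u|)\,\varphi\,dx$$ for every non-negative $\varphi\in C_0^\infty(\mathbb{R}^n)$. *)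

(* Defs.v *)
From HB Require Import structures.
From mathcomp Require Import all_boot all_order all_algebra.
From mathcomp Require Import all_classical all_reals all_analysis.

Set Implicit Arguments.
Unset Strict Implicit.
Unset Printing Implicit Defensive.

Import Order.TTheory GRing.Theory Num.Theory.
Import numFieldNormedType.Exports.

Local Open Scope classical_set_scope.
Local Open Scope ring_scope.

Definition measure_rV_display : measure_display -> measure_display.
Proof. exact. Qed.

(* Row vectors carry the sigma-algebra generated by the coordinates, as
   [n.-tuple T] does in the library. *)
Section measurable_rV.
Context {d} {T : measurableType d} {n : nat}.

Let coors : 'I_n -> 'rV[T]_n -> T := fun i x => x ord0 i.

Let rV_set0 : g_sigma_preimage coors set0.
Proof. exact: sigma_algebra0. Qed.

Let rV_setC A : g_sigma_preimage coors A -> g_sigma_preimage coors (~` A).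
Proof. exact: sigma_algebraC. Qed.

Let rV_bigcup (F : _^nat) : (forall i, g_sigma_preimage coors (F i)) ->
  g_sigma_preimage coors (\bigcup_i (F i)).
Proof. exact: sigma_algebra_bigcup. Qed.

HB.instance Definition _ := @isMeasurable.Build (measure_rV_display d)
  'rV[T]_n (g_sigma_preimage coors) rV_set0 rV_setC rV_bigcup.

Lemma measurable_coord_rV (i : 'I_n) :
  measurable_fun [set: 'rV[T]_n] (fun x : 'rV[T]_n => x ord0 i).
Proof.
move=> _ Y mY; rewrite setTI; apply: sub_sigma_algebra => /=.
rewrite -bigcup_seq/=; exists i => /=; first by rewrite mem_index_enum.
by exists Y => //; rewrite setTI.
Qed.

Lemma measurable_fun_rV d1 (T1 : measurableType d1) (f : T1 -> 'rV[T]_n) :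
  (forall i, measurable_fun [set: T1] (fun x => f x ord0 i)) ->
  measurable_fun [set: T1] f.
Proof.
move=> mf _ A mA; rewrite setTI.
suff : g_sigma_preimage (fun i => coors i \o f) `<=` measurable.
  by apply; rewrite g_sigma_preimage_comp; exists A => //; rewrite setTI.
apply: smallest_sub; first exact: sigma_algebra_measurable.
rewrite -bigcup_seq; apply: bigcup_sub => i _ _ [B mB <-].
exact: mf.
Qed.

End measurable_rV.

Section borel_lebesgue_rV.
Context (R : realType).

Definition rV_cons n (p : R * 'rV[R]_n) : 'rV[R]_n.+1 := row_mx p.1%:M p.2.

Definition rV_uncons n (x : 'rV[R]_n.+1) : R * 'rV[R]_n :=
  (x ord0 ord0, rsubmx (x : 'rV_(1 + n))).

Lemma rV_consE n (p : R * 'rV[R]_n) i :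
  rV_cons p ord0 i = if unlift ord0 i is Some j then p.2 ord0 j else p.1.
Proof.
rewrite /rV_cons; case: unliftP => [j ->|->].
  rewrite (_ : lift _ _ = rshift 1 j); last exact: val_inj.
  by rewrite (row_mxEr (p.1%:M : 'rV_1)).
rewrite (_ : ord0 = lshift n (ord0 : 'I_1)); last exact: val_inj.
by rewrite (row_mxEl (p.1%:M : 'rV_1)) mxE eqxx.
Qed.

Lemma rV_consK n : cancel (@rV_cons n) (@rV_uncons n).
Proof.
by move=> [x y]; rewrite /rV_uncons rV_consE unlift_none row_mxKr.
Qed.

Lemma measurable_rV_cons n : measurable_fun setT (@rV_cons n).
Proof.
apply: measurable_fun_rV => i; under eq_fun do rewrite rV_consE.
case: unlift => [j|]; last exact: measurable_fst.
apply: (measurableT_comp (measurable_coord_rV j)); exact: measurable_snd.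
Qed.

Lemma measurable_rV_uncons n : measurable_fun setT (@rV_uncons n).
Proof.
apply/measurable_fun_pairP; split => /=.
  exact: measurable_coord_rV.
apply: measurable_fun_rV => i /=.
rewrite [X in measurable_fun _ X](_ : _ =
  (fun x : 'rV[R]_n.+1 => x ord0 (rshift 1 i))).
  exact: measurable_coord_rV.
by apply/funext => x; rewrite mxE.
Qed.

Section rV_product_measure.
Context n (mu : {sigma_finite_measure set 'rV[R]_n -> \bar R}).

Definition rV_product_measure : set 'rV[R]_n.+1 -> \bar R :=
  pushforward (@lebesgue_measure R \x mu)%E (@rV_cons n).

HB.instance Definition _ := Measure.copy rV_product_measure
  (measure_function_pushforward__canonical__measure_function_Measure
    (@lebesgue_measure R \x mu)%E (@measurable_rV_cons n)).

Let rV_product_measure_sigma_finite : sigma_finite setT rV_product_measure.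
Proof.
have /sigma_finiteP[F [TF ndF Foo]] := sigma_finiteT (@lebesgue_measure R).
have /sigma_finiteP[G [TG ndG Goo]] := sigma_finiteT mu.
exists (fun k => @rV_uncons n @^-1` (F k `*` G k)).
  rewrite -preimage_bigcup (_ : \bigcup_k _ = setT) ?preimage_setT//.
  apply/seteqP; split => // -[x y] _.
  have [i _ Fix] : (\bigcup_k F k) x by rewrite -TF.
  have [j _ Gjy] : (\bigcup_k G k) y by rewrite -TG.
  exists (maxn i j) => //; split => /=.
  - by move: Fix; exact/subsetPset/ndF/leq_maxl.
  - by move: Gjy; exact/subsetPset/ndG/leq_maxr.
move=> k; have [mFk Fkoo] := Foo k; have [mGk Gkoo] := Goo k; split.
  rewrite -[_ @^-1` _]setTI; apply: measurable_rV_uncons => //.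
  exact: measurableX.
rewrite /rV_product_measure /pushforward.
rewrite (_ : _ @^-1` _ = F k `*` G k); last first.
  rewrite -comp_preimage (_ : _ \o _ = id) ?preimage_id//.
  by apply/funext => p; exact: rV_consK.
by rewrite product_measure1E// lte_mul_pinfty// ge0_fin_numE.
Qed.

HB.instance Definition _ := Measure_isSigmaFinite.Build _ _ _
  rV_product_measure rV_product_measure_sigma_finite.

End rV_product_measure.

(* Lebesgue measure on the Borel sets of R^n: the n-fold product of the
   one-dimensional one. *)
Fixpoint borel_lebesgue_rV n : {sigma_finite_measure set 'rV[R]_n -> \bar R} :=
  if n is n'.+1 then rV_product_measure (borel_lebesgue_rV n')
  else \d_(0 : 'rV[R]_0).

Definition box_rV n (a b : 'rV[R]_n) : set 'rV[R]_n :=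
  [set x | forall i, a ord0 i <= x ord0 i <= b ord0 i].

Lemma measurable_box_rV n (a b : 'rV[R]_n) : measurable (box_rV a b).
Proof.
rewrite (_ : box_rV a b = \bigcap_(i in [set: 'I_n])
    ((fun x : 'rV[R]_n => x ord0 i) @^-1` `[a ord0 i, b ord0 i]%classic)).
  apply: fin_bigcap_measurable => // i _.
  by rewrite -[_ @^-1` _]setTI; exact: measurable_coord_rV.
apply/seteqP; split => x /= xab.
  by move=> i _ /=; rewrite in_itv/=; exact: xab.
by move=> i; have := xab i I; rewrite /= in_itv.
Qed.

Lemma borel_lebesgue_rV_box n (a b : 'rV[R]_n) :
  (forall i, a ord0 i <= b ord0 i) ->
  borel_lebesgue_rV n (box_rV a b) = (\prod_i (b ord0 i - a ord0 i))%:E.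
Proof.
elim: n => [|n IH] in a b * => ab.
  by rewrite big_ord0 /= diracE mem_set// => -[].
rewrite /= /rV_product_measure /pushforward big_ord_recl EFinM.
pose t (x : 'rV[R]_n.+1) : 'rV[R]_n := \row_j x ord0 (lift ord0 j).
rewrite (_ : _ @^-1` _ =
    `[a ord0 ord0, b ord0 ord0]%classic `*` box_rV (t a) (t b)); last first.
  apply/seteqP; split => -[x y] /=.
    move=> xy; split => [|j] /=.
      by have := xy ord0; rewrite rV_consE unlift_none /= in_itv.
    by have := xy (lift ord0 j); rewrite rV_consE liftK /= !mxE.
  move=> [/= x01 y01] i; rewrite rV_consE; case: unliftP => [j ->|->] /=.
    by have := y01 j; rewrite !mxE.
  by move: x01; rewrite in_itv.
rewrite product_measure1E//; last exact: measurable_box_rV.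
rewrite IH; last by move=> j; rewrite !mxE.
congr (_ * _)%E.
  rewrite [LHS]lebesgue_measure_itv/= lte_fin.
  by have := ab ord0; rewrite le_eqVlt => /orP[/eqP ->|->//];
    rewrite ltxx subrr.
by congr EFin; apply: eq_bigr => j _; rewrite !mxE.
Qed.

End borel_lebesgue_rV.

(* R^n with the Lebesgue measurable sets, and Lebesgue measure on it. The
   completion matters: for a Caratheodory function f, continuous in its second
   argument for almost every x only, f x (u x) need not be Borel measurable. *)
Definition lebesgueType (R : realType) n : Type :=
  caratheodory_type ((borel_lebesgue_rV R n)^*)%mu.

HB.instance Definition _ (R : realType) n := Measurable.copy (lebesgueType R n)
  (caratheodory_type ((borel_lebesgue_rV R n)^*)%mu).

Definition lebesgue_rV (R : realType) n : set (lebesgueType R n) -> \bar R :=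
  @completed_measure_extension _ _ _ (borel_lebesgue_rV R n).

HB.instance Definition _ (R : realType) n := Measure.on (@lebesgue_rV R n).

HB.instance Definition _ (R : realType) n :=
  Measure_isSigmaFinite.Build _ _ _ (@lebesgue_rV R n)
    (completed_measure_extension_sigma_finite
      (sigma_finiteT (borel_lebesgue_rV R n))).

Lemma lebesgue_rV_box (R : realType) n (a b : 'rV[R]_n) :
  (forall i, a ord0 i <= b ord0 i) ->
  lebesgue_rV (box_rV a b) = (\prod_i (b ord0 i - a ord0 i))%:E.
Proof.
move=> ab; rewrite -borel_lebesgue_rV_box//.
by apply: measurable_mu_extE; exact: measurable_box_rV.
Qed.

Definition locally_integrable_rV (R : realType) n (u : 'rV[R]_n -> R) :=
  measurable_fun [set: lebesgueType R n] u /\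
  forall K : set 'rV[R]_n, compact K ->
    (@lebesgue_rV R n).-integrable K (EFin \o u).

Definition multi_index n m : finType :=
  {alpha : {ffun 'I_n -> 'I_m.+1} | (\sum_i alpha i == m)%N}.

Section smooth.
Context {R : realType} {n : nat}.
Implicit Types (f : 'rV[R]_n -> R) (x : 'rV[R]_n).

Definition partial (i : 'I_n) f : 'rV[R]_n -> R :=
  fun x => 'D_(delta_mx ord0 i) f x.

Definition partial_multi m (alpha : multi_index n m) f : 'rV[R]_n -> R :=
  foldr (fun i => iter (val alpha i) (partial i)) f (enum 'I_n).

(* [s] lists the variables of an iterated partial derivative, in any order. *)
Definition smooth f := forall s : seq 'I_n,
  let h := foldr partial f s in
  continuous h /\ forall i x, derivable h x (delta_mx ord0 i).

Definition test_function f :=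
  smooth f /\ compact (closure [set x | f x != 0]).

End smooth.

Definition caratheodory_function (R : realType) n (f : 'rV[R]_n -> R -> R) :=
  (forall z, measurable_fun [set: lebesgueType R n] (f ^~ z)) /\
  {ae @lebesgue_rV R n, forall x, continuous (f x)}.

Definition global_weak_solution (R : realType) m n
    (a : multi_index n m -> 'rV[R]_n -> R -> R) (g : R -> R)
    (u : 'rV[R]_n -> R) :=
  [/\ locally_integrable_rV u,
      locally_integrable_rV (fun x => g `|u x|) &
      forall phi : 'rV[R]_n -> R, test_function phi -> (forall x, 0 <= phi x) ->
      (\int[@lebesgue_rV R n]_x (g `|u x| * phi x)%:E <=
       \int[@lebesgue_rV R n]_x
         (\sum_alpha (-1) ^+ m * a alpha x (u x) *
            partial_multi alpha phi x)%:E)%E].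

(* Main.v *)
Require Import Defs.
From mathcomp Require Import all_boot all_order all_algebra.
From mathcomp Require Import all_classical all_reals all_analysis.
From mathcomp Require Import measurable_realfun ring lra.

Import Order.TTheory GRing.Theory Num.Theory.
Import numFieldNormedType.Exports.

Local Open Scope classical_set_scope.
Local Open Scope ring_scope.

(** Test the inequality with a smooth cutoff between the cubes [-r, r]^n and
[-r-d, r+d]^n, whose derivatives of order m are O(d^(-m)). As |a(x, u)| <= A |u|,
this gives the energy estimate [energy_estimate]: the integral of g(|u|) over
the small cube is at most K d^(-m) times the integral of |u| over the large
one. A weak form of Jensen's inequality [convex_half_mean] turns the left-hand
side into g of (half) the mean of |u|. For r in [rho, 2 rho], the integral w(r)
of |u| over the cube of radius r, normalised by a fixed volume, thus satisfies
g(w(r)) <= K' d^(-m) w(r + d) with K' independent of rho.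

This is the Keller-Osserman situation. Choosing d = (2 K' w(r) / g(w(r)))^(1/m)
the estimate says that w doubles between r and r + d. By monotonicity of the
integrand, d is at most a constant times the integral of
g^(-1/m) z^(1/m - 1) over ]w(r)/2, w(r)]. These intervals are disjoint along
the iteration, so that all the doublings take place within a distance bounded
by the total integral, independently of rho [growth_blows_up]. For rho large
this leaves w unbounded on [rho, 2 rho], which is absurd
[mean_growth_contradiction]. To start the iteration w has to be positive
somewhere; this comes from g(0) > 0, which the convergence of the integral at 0
forces [osserman_profile_gt0].

The cutoffs are tensor products of functions of one variable built from
exp(-1/x), so that their partial derivatives are explicit. The flux
a(x, u(x)) is compared with a multiple of |u| under the integral sign by
[ae_le_integral_nomeas]: integrals of nonnegative functions, being suprema
over simple functions, are monotone for arbitrary functions. *)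

(** * Functions with derivatives of all orders *)

Section smooth_step.
Variable R : realType.
Implicit Types (f g : R -> R) (x y : R) (k : nat).

(** Defined by recursion on the order so that stability under products and
inverses follows by one induction: the derivative of a product is again a sum
of products, with no Leibniz formula to write down. *)
Fixpoint times_derivable k f : Prop :=
  if k is k'.+1 then
    exists2 f' : R -> R, (forall x, is_derive x 1 f (f' x)) & times_derivable k' f'
  else True.

Lemma times_derivableW k f : times_derivable k.+1 f -> times_derivable k f.
Proof.
elim: k f => [//|k IH] f [f' df' /IH f'k]; by exists f'.
Qed.

Lemma times_derivable_cst k (c : R) : times_derivable k (cst c).
Proof.
elim: k c => [//|k IH] c; exists (cst 0) => // x; exact: is_derive_cst.
Qed.

Lemma times_derivableD k f g : times_derivable k f -> times_derivable k g ->
  times_derivable k (f \+ g).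
Proof.
elim: k f g => [//|k IH] f g [f' df kf] [g' dg kg].
by exists (f' \+ g'); [move=> x; exact: is_deriveD|exact: IH].
Qed.

Lemma times_derivableM k f g : times_derivable k f -> times_derivable k g ->
  times_derivable k (f \* g).
Proof.
elim: k f g => [//|k IH] f g fk gk.
move: (fk) (gk) => [f' df kf'] [g' dg kg'].
exists ((f \* g') \+ (g \* f')); first by move=> x; exact: is_deriveM.
by apply: times_derivableD; apply: IH => //; exact: times_derivableW.
Qed.

(** Since 1/f has derivative - f' * (1/f) * (1/f), the inverse of a function
differentiable k+1 times is as smooth as f' and 1/f are, and the induction
hypothesis applies to the latter. *)
Lemma times_derivableV k f : (forall x, f x != 0) -> times_derivable k f ->
  times_derivable k (fun x => (f x)^-1).
Proof.
move=> f0; elim: k => [//|k IH] fk; have fVk := IH (times_derivableW _ _ fk).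
case: fk => f' df kf'.
exists (((fun x => (f x)^-1) \* (fun x => (f x)^-1)) \* (cst (-1) \* f')).
  move=> x; apply: is_derive_eq.
  by rewrite /= /GRing.scale /= expr2 invfM; ring.
apply: times_derivableM; first exact: times_derivableM.
by apply: times_derivableM => //; exact: times_derivable_cst.
Qed.

Lemma times_derivable_reflect k f :
  times_derivable k f -> times_derivable k (fun x => f (1 - x)).
Proof.
elim: k f => [//|k IH] f [f' df kf'].
exists (cst (-1) \* (fun x => f' (1 - x))) => [x|]; last first.
  by apply: times_derivableM; [exact: times_derivable_cst|exact: IH].
rewrite /= mulN1r -mulrN1; apply: (@is_derive1_comp _ f (fun x => 1 - x)) => //.
by apply: is_derive_eq; rewrite add0r mul1r.
Qed.

Lemma times_derivable_derive1n k f : times_derivable k.+1 f ->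
  forall x, is_derive x 1 f^`(k)%classic (f^`(k.+1)%classic x).
Proof.
elim: k f => [|k IH] f [f' df kf'] x.
  by rewrite derive1n1 derive1E; have [] := df x; move=> *; apply: DeriveDef.
have -> : f^`(k.+1)%classic = f'^`(k)%classic.
  rewrite derive1Sn; congr (derive1n k _); apply/funext => y.
  by rewrite derive1E; have [] := df y.
have -> : f^`(k.+2)%classic = f'^`(k.+1)%classic.
  rewrite derive1Sn; congr (derive1n k.+1 _); apply/funext => y.
  by rewrite derive1E; have [] := df y.
exact: IH.
Qed.

(** The functions x^(-k) * exp (-1/x), extended by 0 to the half-line x <= 0.
Powers of 1/x suffice here, with no general polynomials, because the
derivative of such a function is a combination of two others; the family is
thus closed under differentiation up to linear combinations. *)
Definition flat k x : R := if 0 < x then x^-1 ^+ k * expR (- x^-1) else 0.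

Lemma exprn_le_expR k y : 0 <= y -> y ^+ k <= k`!%:R * expR y.
Proof.
move=> y0; case: k => [|k].
  by rewrite expr0 fact0 mul1r (le_trans _ (expR_ge1Dx y))// lerDl.
have := expR_ge1Dxn k y0.
have f0 : 0 < (k.+1)`!%:R :> R by rewrite ltr0n fact_gt0.
move=> h; rewrite mulrC -ler_pdivrMr//; apply: le_trans h.
by rewrite lerDr.
Qed.

Lemma flat_ge0 k x : 0 <= flat k x.
Proof.
rewrite /flat; case: ltP => // x0.
by rewrite mulr_ge0 ?expR_ge0// exprn_ge0// invr_ge0 ltW.
Qed.

(** The exponential beats y^(k+2) at y = 1/x, which leaves a factor x^2: this
is the decay at the origin that makes all the functions [flat] glue smoothly
with 0. *)
Lemma flat_le k x : flat k x <= (k.+2)`!%:R * x ^+ 2.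
Proof.
rewrite /flat; case: ltP => [x0|_]; last by rewrite mulr_ge0 ?ler0n ?sqr_ge0.
have xV0 : 0 <= x^-1 by rewrite invr_ge0 ltW.
have := exprn_le_expR k.+2 _ xV0.
rewrite -ler_pdivrMr ?expR_gt0// -expRN => h.
have -> : x^-1 ^+ k * expR (- x^-1) = x^-1 ^+ k.+2 * expR (- x^-1) * x ^+ 2.
  by rewrite !exprS; field; rewrite gt_eqF.
by rewrite ler_wpM2r// sqr_ge0.
Qed.

Lemma flat_continuous0 k : {for 0, continuous (flat k)}.
Proof.
rewrite /prop_for /continuous_at {2}/flat ltxx.
apply: (@squeeze_cvgr _ _ _ _ (cst 0) (fun x => (k.+2)`!%:R * x ^+ 2)).
- by near=> x; rewrite flat_ge0 flat_le.
- exact: cvg_cst.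
- rewrite -[X in _ --> X](_ : (k.+2)`!%:R * 0 ^+ 2 = 0 :> R).
    by apply: cvgM; [exact: cvg_cst|exact: exprn_continuous].
  by rewrite expr0n mulr0.
Unshelve. all: by end_near. Qed.

Lemma is_derive_flat k x :
  is_derive x 1 (flat k) (flat k.+2 x - k%:R * flat k.+1 x).
Proof.
have [x0|x0|<-] := ltgtP 0 x.
- apply: (@near_eq_is_derive _ _ _ (fun y => y^-1 ^+ k * expR (- y^-1))).
    near=> y; rewrite /flat ifT//; near: y; exact: lt_nbhsr.
  have dV : is_derive x 1 (fun y : R => y^-1) (- x ^- 2).
    apply: is_derive_eq; first by apply: (@is_deriveV _ id x 1 1); rewrite gt_eqF.
    by rewrite /GRing.scale /= mulr1.
  have dE : is_derive x 1 (fun y : R => expR (- y^-1)) (expR (- x^-1) * x ^- 2).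
    apply: (@is_derive1_comp _ expR (fun y : R => - y^-1)).
    by apply: is_derive_eq; rewrite opprK.
  have dX : is_derive x 1 (fun y : R => y^-1 ^+ k)
      (k%:R * x^-1 ^+ k.-1 * - x ^- 2).
    have -> : (fun y : R => y^-1 ^+ k) = (fun y : R => y^-1) ^+ k.
      by rewrite exprfctE.
    exact: is_deriveX.
  apply: (is_derive_eq (is_deriveM dX dE)).
  rewrite /flat x0 /GRing.scale /=; case: k {dX} => [|k] /=.
    by rewrite !mul0r; field; rewrite gt_eqF.
  by rewrite !exprS; field; rewrite gt_eqF.
- apply: (@near_eq_is_derive _ _ _ (cst 0)).
    near=> y; rewrite /flat lt_gtF//.
    near: y; exact: lt_nbhsl.
  by rewrite /flat !(lt_gtF x0) mulr0 subr0; exact: is_derive_cst.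
(* The slope flat k z / z at the origin is flat k.+1 z itself. *)
- apply/is_derive1_caratheodory; exists (flat k.+1); split.
  + move=> z; rewrite subr0 /flat ltxx subr0; case: ifPn => [z0|].
      by rewrite exprS; field; rewrite gt_eqF.
    by rewrite mul0r.
  + exact: flat_continuous0.
  + by rewrite /flat ltxx mulr0 subr0.
Unshelve. all: by end_near. Qed.

Lemma times_derivable_flat j k : times_derivable j (flat k).
Proof.
elim: j k => [//|j IH] k.
exists (flat k.+2 \+ (cst (- k%:R) \* flat k.+1)).
  move=> x; apply: is_derive_eq; first exact: is_derive_flat.
  by rewrite /= mulNr.
apply: times_derivableD => //; apply: times_derivableM => //.
exact: times_derivable_cst.
Qed.

End smooth_step.

(** * Cutoff functions on the line *)

Section cutoff.
Variable R : realType.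
Implicit Types (x t r d C : R) (k m : nat).

Definition step x : R := flat R 0 x / (flat R 0 x + flat R 0 (1 - x)).

Lemma step_denominator_gt0 x : 0 < flat R 0 x + flat R 0 (1 - x).
Proof.
have f0 y : 0 < y -> 0 < flat R 0 y.
  by move=> y0; rewrite /flat y0 expr0 mul1r expR_gt0.
case: (ltP 0 x) => x0; first by rewrite ltr_wpDr ?flat_ge0 ?f0.
by rewrite ltr_wpDl ?flat_ge0 ?f0// subr_gt0 (le_lt_trans x0).
Qed.

Lemma step0 x : x <= 0 -> step x = 0.
Proof. by move=> x0; rewrite /step {1}/flat le_gtF// mul0r. Qed.

Lemma step1 x : 1 <= x -> step x = 1.
Proof.
move=> x1; have f1x : flat R 0 (1 - x) = 0 by rewrite /flat le_gtF ?subr_le0.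
have := step_denominator_gt0 x; rewrite /step f1x addr0 => f0.
by rewrite divff// gt_eqF.
Qed.

Lemma step_ge0 x : 0 <= step x.
Proof. by rewrite divr_ge0 ?flat_ge0// ltW// step_denominator_gt0. Qed.

Lemma is_derive_step k x : is_derive x 1 step^`(k)%classic (step^`(k.+1)%classic x).
Proof.
apply: times_derivable_derive1n.
apply: (times_derivableM _ _ _ (fun x => (flat R 0 x + flat R 0 (1 - x))^-1)).
  exact: times_derivable_flat.
apply: times_derivableV; first by move=> y; rewrite gt_eqF ?step_denominator_gt0.
apply: (times_derivableD _ _ _ (fun x => flat R 0 (1 - x))).
  exact: times_derivable_flat.
by apply: (times_derivable_reflect _ _ (flat R 0)); exact: times_derivable_flat.
Qed.

Lemma derive1_locally_cst (f : R -> R) (c : R) x :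
  (\near x, f x = c) -> (f^`() x)%classic = 0.
Proof.
by move=> fc; rewrite derive1E (near_eq_derive (g := cst c))// derive_cst.
Qed.

Lemma derive1n_step_lt0 k x : x < 0 -> (step^`(k) x)%classic = 0.
Proof.
elim: k x => [|k IH] x x0; first by rewrite derive1n0 step0// ltW.
rewrite derive1nS; apply: (@derive1_locally_cst _ 0).
by near=> y; apply: IH; near: y; exact: lt_nbhsl.
Unshelve. all: by end_near. Qed.

Lemma derive1n_step_gt1 k x : 1 < x -> (step^`(k) x)%classic = (k == 0%N)%:R.
Proof.
elim: k x => [|k IH] x x1; first by rewrite derive1n0 step1// ltW.
rewrite derive1nS; apply: (@derive1_locally_cst _ (k == 0%N)%:R).
by near=> y; apply: IH; near: y; exact: lt_nbhsr.
Unshelve. all: by end_near. Qed.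

(** Off the segment [0, 1] the derivatives of the step are constant, so that
their continuity there is enough for a bound. *)
Lemma derive1n_step_bounded k :
  exists C, forall x, `|(step^`(k) x)%classic| <= C.
Proof.
have cD : continuous (fun x => `|(step^`(k) x)%classic|).
  move=> x; apply: continuous_comp; last exact: norm_continuous.
  have [dx _] := is_derive_step k x.
  exact/differentiable_continuous/derivable1_diffP.
have [c _ cmax] := EVT_max ler01 (continuous_subspaceT cD).
exists (`|(step^`(k) c)%classic| + 1) => x.
have [x0|x0] := ltP x 0.
  by rewrite derive1n_step_lt0// normr0 addr_ge0.
have [x1|x1] := ltP 1 x.
  by rewrite derive1n_step_gt1// normr_nat ler_wpDl// lern1 leq_b1.
by rewrite (le_trans (cmax x _)) ?lerDl// in_itv/= x0 x1.
Qed.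

Lemma derive1n_step_uniformly_bounded m : exists2 C, 1 <= C &
  forall k, (k <= m)%N -> forall x, `|(step^`(k) x)%classic| <= C.
Proof.
elim: m => [|m [C C1 IH]].
  have [C hC] := derive1n_step_bounded 0.
  exists (Num.max 1 C); first by rewrite le_max lexx.
  by move=> k; rewrite leqn0 => /eqP -> x; rewrite le_max hC orbT.
have [C' hC'] := derive1n_step_bounded m.+1.
exists (Num.max C C'); first by rewrite le_max C1.
move=> k; rewrite leq_eqVlt => /predU1P[->|km] x.
  by rewrite le_max hC' orbT.
by rewrite le_max IH.
Qed.

(** The derivative of order k of the cutoff that equals 1 on [-r, r] and 0
off [-r-d, r+d]. The cutoff is the sum, minus 1, of a decreasing and of an
increasing step of width d rather than their product, so that its derivatives
are linear in those of [step] and plainly scale like d^(-k). *)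
Definition cutoff r d k t : R :=
  (- d^-1) ^+ k * step^`(k)%classic ((r + d - t) / d) +
  d^-1 ^+ k * step^`(k)%classic ((r + d + t) / d) - (k == 0%N)%:R.

Lemma is_derive_cutoff r d k t :
  is_derive t 1 (cutoff r d k) (cutoff r d k.+1 t).
Proof.
have dstep (e : R) : is_derive t 1
    (fun s => step^`(k)%classic ((r + d + e * s) / d))
    (step^`(k.+1)%classic ((r + d + e * t) / d) * (e / d)).
  apply: (@is_derive1_comp _ step^`(k)%classic (fun s => (r + d + e * s) / d)).
    exact: is_derive_step.
  by apply: is_derive_eq; rewrite /GRing.scale /=; ring.
rewrite /cutoff; have := dstep (-1); have := dstep 1.
set p := (fun s => _) => dp; set q := (fun s => _) => dq.
have -> : (fun s => (- d^-1) ^+ k * step^`(k)%classic ((r + d - s) / d) +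
    d^-1 ^+ k * step^`(k)%classic ((r + d + s) / d) - (k == 0%N)%:R) =
    ((- d^-1) ^+ k \*: q) + (d^-1 ^+ k \*: p) - cst (k == 0%N)%:R.
  apply/funext => s; transitivity ((- d^-1) ^+ k * q s + d^-1 ^+ k * p s -
    (k == 0%N)%:R) => //.
  by rewrite /p /q mulN1r mul1r.
apply: (is_derive_eq (is_deriveB (is_deriveD (is_deriveZ _ dq)
  (is_deriveZ _ dp)) (is_derive_cst _ _ _))).
by rewrite /GRing.scale /= mulN1r mul1r !exprS; ring.
Qed.

(** At most one of the two steps differs from 1 at any given point. *)
Lemma cutoff0E r d t : 0 < d -> 0 <= r ->
  cutoff r d 0 t = step ((r + d - `|t|) / d).
Proof.
move=> d0 r0; rewrite /cutoff !expr0 !mul1r !derive1n0 /=.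
have le1 s : 0 <= s -> 1 <= (r + d + s) / d.
  by move=> s0; rewrite ler_pdivlMr// mul1r; lra.
have [t0|t0] := leP 0 t.
  by rewrite ger0_norm// (step1 ((r + d + t) / d) (le1 _ t0)) addrK.
rewrite ltr0_norm// opprK (step1 ((r + d - t) / d)) ?le1 ?oppr_ge0 ?ltW//.
by rewrite addrC addrA addNr add0r.
Qed.

Lemma cutoff0_ge0 r d t : 0 < d -> 0 <= r -> 0 <= cutoff r d 0 t.
Proof. by move=> d0 r0; rewrite cutoff0E// step_ge0. Qed.

Lemma cutoff0_eq1 r d t : 0 < d -> 0 <= r -> `|t| <= r -> cutoff r d 0 t = 1.
Proof.
move=> d0 r0 tr; rewrite cutoff0E// step1// ler_pdivlMr// mul1r; lra.
Qed.

Lemma cutoff_eq0 r d k t : 0 < d -> 0 <= r -> r + d < `|t| ->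
  cutoff r d k t = 0.
Proof.
move=> d0 r0 rt.
have lt0 s : r + d < s -> (r + d - s) / d < 0.
  by move=> hs; rewrite ltr_pdivrMr// mul0r subr_lt0.
have gt1 s : r + d < s -> 1 < (r + d + s) / d.
  by move=> hs; rewrite ltr_pdivlMr// mul1r; lra.
rewrite /cutoff; have [t0|t0] := leP 0 t.
  rewrite ger0_norm// in rt.
  rewrite derive1n_step_lt0 ?lt0// derive1n_step_gt1 ?gt1// mulr0 add0r.
  by case: k => [|k]; rewrite ?expr0 ?mulr1 ?mulr0 subrr.
rewrite ltr0_norm// in rt.
rewrite [r + d + t](_ : _ = r + d - - t); last by rewrite opprK.
rewrite derive1n_step_gt1 ?gt1// derive1n_step_lt0 ?lt0// mulr0 addr0.
by case: k => [|k]; rewrite ?expr0 ?mulr1 ?mulr0 subrr.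
Qed.

Lemma cutoff_bounded C r d k t : 0 < d -> 1 <= C ->
  (forall x, `|(step^`(k) x)%classic| <= C) ->
  `|cutoff r d k t| <= 3 * C * d^-1 ^+ k.
Proof.
move=> d0 C1 hC.
have dk : 0 <= d^-1 ^+ k by rewrite exprn_ge0// invr_ge0 ltW.
have b (e s : R) : `|e| = d^-1 ^+ k -> `|e * (step^`(k) s)%classic| <= C * d^-1 ^+ k.
  by move=> he; rewrite normrM he mulrC ler_wpM2r.
rewrite (_ : 3 * C * _ = C * d^-1 ^+ k + C * d^-1 ^+ k + C * d^-1 ^+ k);
  last by ring.
apply: (le_trans (ler_normB _ _)); apply: lerD; last first.
  rewrite normr_nat; case: k dk {hC b} => [|k] dk; first by rewrite expr0 mulr1.
  by rewrite mulr_ge0// (le_trans _ C1).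
apply: (le_trans (ler_normD _ _)); apply: lerD; apply: b.
  by rewrite normrX normrN ger0_norm// invr_ge0 ltW.
by rewrite ger0_norm.
Qed.

End cutoff.

(** * Products of functions of one coordinate *)

Section tensor.
Variables (R : realType) (n : nat) (F : nat -> R -> R).
Hypothesis dF : forall k (t : R), is_derive t 1 (F k) (F k.+1 t).
Implicit Types (a : 'I_n -> nat) (x : 'rV[R]_n) (s : seq 'I_n).

(** Here F k stands for the k-th derivative of F 0, so that partial derivatives
of [tensor] only increment the exponent a. *)
Definition tensor a x : R := \prod_i F (a i) (x ord0 i).

(** Along the j-th axis all the factors but one are constant: the difference
quotient of the product is literally that of its j-th factor times the
others. *)
Lemma is_derive_tensor a j x :
  is_derive x (delta_mx ord0 j) (tensor a)
    (tensor (fun i => a i + (i == j))%N x).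
Proof.
pose P := \prod_(i | i != j) F (a i) (x ord0 i).
have [dG vG] : is_derive (x ord0 j) 1 (P \*: F (a j)) (P *: F (a j).+1 (x ord0 j)).
  exact: is_deriveZ.
have tensorE (h : R) : tensor a (h *: delta_mx ord0 j + x) =
    P * F (a j) (h *: 1 + x ord0 j).
  rewrite /tensor (bigD1 j)//= mulrC !mxE !eqxx; congr (_ * _).
  by apply: eq_bigr => i ij; rewrite !mxE eqxx (negbTE ij) mulr0 add0r.
have tensorxE : tensor a x = P * F (a j) (x ord0 j).
  by rewrite /tensor (bigD1 j)//= mulrC.
have quotE : (fun h : R => h^-1 *: ((tensor a \o shift x) (h *: delta_mx ord0 j)
     - tensor a x)) =
  (fun h => h^-1 *: (((P \*: F (a j)) \o shift (x ord0 j)) (h *: 1)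
     - (P \*: F (a j)) (x ord0 j))).
  by apply/funext => h; rewrite /= tensorE tensorxE.
apply: DeriveDef; first by rewrite /derivable quotE.
rewrite /derive quotE; apply: (etrans vG).
rewrite /tensor (bigD1 j)//= mulrC eqxx addn1; congr (_ * _).
by apply: eq_bigr => i ij; rewrite (negbTE ij) addn0.
Qed.

Lemma continuous_tensor a : continuous (tensor a).
Proof.
rewrite /tensor; elim: (index_enum _) => [|i s IH] x.
  rewrite (_ : (fun y => _) = cst 1); first exact: cst_continuous.
  by apply/funext => y; rewrite big_nil.
rewrite (_ : (fun y => _) = (fun y : 'rV[R]_n => F (a i) (y ord0 i)) \*
    (fun y => \prod_(j <- s) F (a j) (y ord0 j))); last first.
  by apply/funext => y; rewrite big_cons.
apply: continuousM; last exact: IH.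
apply: continuous_comp; first exact: coord_continuous.
have [dFi _] := dF (a i) (x ord0 i).
exact/differentiable_continuous/derivable1_diffP.
Qed.

Lemma foldr_partial_tensor a s :
  foldr partial (tensor a) s = tensor (fun i => a i + count_mem i s)%N.
Proof.
elim: s => [|j s IH] /=.
  by congr tensor; apply/funext => i; rewrite addn0.
rewrite IH; apply/funext => x; rewrite /partial.
have [_ ->] := is_derive_tensor (fun i => a i + count_mem i s)%N j x.
by congr tensor; apply/funext => i; rewrite addnAC addnA (eq_sym j).
Qed.

Lemma smooth_tensor a : smooth (tensor a).
Proof.
move=> s /=; rewrite foldr_partial_tensor; split; first exact: continuous_tensor.
by move=> i x; have [] := is_derive_tensor (fun i => a i + count_mem i s)%N i x.
Qed.

Lemma partial_multi_tensor m (alpha : multi_index n m) :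
  partial_multi alpha (tensor (fun=> 0%N)) = tensor (fun i => val alpha i).
Proof.
have -> : partial_multi alpha (tensor (fun=> 0%N)) =
    foldr partial (tensor (fun=> 0%N))
      (flatten [seq nseq (val alpha i) i | i <- enum 'I_n]).
  rewrite /partial_multi; elim: (enum _) => //= i s ->.
  by rewrite foldr_cat; elim: (nat_of_ord _) => //= k ->.
rewrite foldr_partial_tensor; congr tensor; apply/funext => i.
rewrite add0n count_flatten -map_comp sumnE big_map big_enum /= (bigD1 i)//=.
rewrite count_nseq /= eqxx mul1n big1 ?addn0// => j ji.
by rewrite count_nseq /= (negbTE ji) mul0n.
Qed.

End tensor.

(** * Integrals of functions that need not be measurable *)

Section domination.
Context d (T : measurableType d) (R : realType).
Variable mu : {measure set T -> \bar R}.
Local Open Scope ereal_scope.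

(** The integral of a nonnegative function is a supremum over the simple
functions below it, hence monotone whether or not the functions are
measurable. *)
Lemma ge0_le_integral_nomeas (f h : T -> \bar R) :
  (forall x, 0 <= f x) -> (forall x, f x <= h x) ->
  \int[mu]_x f x <= \int[mu]_x h x.
Proof.
move=> f0 fh; have h0 x : 0 <= h x by exact: le_trans (fh x).
rewrite !ge0_integralTE//; apply: ereal_sup_le => _ [s sf <-].
by exists s => // x; exact: le_trans (fh x).
Qed.

(** Meant for f the flux term of a weak solution and h a multiple of |u|: raising
h to +oo on a null set turns the inequality almost everywhere into an
inequality everywhere, and keeps the integral of h. *)
Lemma ae_le_integral_nomeas (f h : T -> \bar R) :
  measurable_fun [set: T] h -> (forall x, 0 <= h x) ->
  {ae mu, forall x, f x <= h x} -> \int[mu]_x f x <= \int[mu]_x h x.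
Proof.
move=> mh h0 [N [mN N0 fhN]].
have NT0 x : 0 <= ((cst +oo : T -> \bar R) \_ N) x.
  by rewrite patchE; case: ifP => _ /=; rewrite ?leey ?lexx.
have -> : \int[mu]_x h x = \int[mu]_x (h x + ((cst +oo) \_ N) x).
  rewrite ge0_integralD//; last exact/(measurable_restrictT _ _).1.
  by rewrite -integral_mkcond integral_cst// N0 mule0 adde0.
rewrite integralE; apply: (@le_trans _ _ (\int[mu]_x f^\+ x)).
  rewrite -[leRHS]adde0; apply: leeD2l; rewrite oppe_le0.
  exact: integral_ge0.
apply: ge0_le_integral_nomeas => // x; rewrite funeposE ge_max adde_ge0// andbT.
have [xN|xN] := boolP (x \in N).
  by rewrite patchE xN addey ?leey// gt_eqF// (lt_le_trans _ (h0 x)).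
rewrite patchE (negbTE xN) adde0; apply: contrapT => fh.
by move/negP: xN; apply; rewrite inE; exact: fhN.
Qed.

End domination.

(** * Cubes and their cutoff functions *)

Section cube.
Variables (R : realType) (n : nat).
Implicit Types (r d C : R) (x : 'rV[R]_n).

Definition cube r : set 'rV[R]_n := box_rV (const_mx (- r)) (const_mx r).

Lemma cubeP r x : cube r x <-> forall i, `|x ord0 i| <= r.
Proof.
by split=> xr i; have := xr i; rewrite !mxE -ler_norml.
Qed.

Lemma subset_cube r d : 0 <= d -> cube r `<=` cube (r + d).
Proof.
move=> d0 x /cubeP xr; apply/cubeP => i.
by rewrite (le_trans (xr i))// lerDl.
Qed.

Lemma compact_cube r : compact (cube r).
Proof.
rewrite (_ : cube r = [set x | forall i, `[- r, r]%classic (x ord0 i)]).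
  by apply: (@rV_compact _ _ (fun=> `[- r, r]%classic)) => i; exact: segment_compact.
by apply/seteqP; split => x xr i; have := xr i; rewrite /= in_itv/= !mxE.
Qed.

Lemma measurable_cube r : measurable (cube r : set (lebesgueType R n)).
Proof.
apply: sub_caratheodory; apply: sub_sigma_algebra.
exact: measurable_box_rV.
Qed.

Lemma lebesgue_cube r : 0 <= r ->
  @lebesgue_rV R n (cube r) = ((2 * r) ^+ n)%:E.
Proof.
move=> r0; rewrite lebesgue_rV_box => [|i]; last by rewrite !mxE ge0_cp.
congr EFin; under eq_bigr do rewrite !mxE opprK -mulr2n -mulr_natl.
by rewrite prodr_const card_ord.
Qed.

Definition cube_cutoff r d : 'rV[R]_n -> R :=
  tensor R n (cutoff R r d) (fun=> 0%N).

Section cube_cutoff_theory.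
Variables (r d : R).
Hypotheses (r0 : 0 <= r) (d0 : 0 < d).

Lemma partial_cube_cutoff_eq0 m (alpha : multi_index n m) x :
  ~ cube (r + d) x -> partial_multi alpha (cube_cutoff r d) x = 0.
Proof.
move=> /cubeP/existsNP[i /negP]; rewrite -ltNge => xi.
rewrite (partial_multi_tensor _ _ _ (is_derive_cutoff R r d)).
by rewrite /tensor (bigD1 i)//= cutoff_eq0// mul0r.
Qed.

(** The factors of a derivative of multi-index alpha contribute d^(-alpha_i)
each, and the alpha_i add up to m. *)
Lemma partial_cube_cutoff_bounded m C (alpha : multi_index n m) x : 1 <= C ->
  (forall k, (k <= m)%N -> forall t, `|(step R)^`(k)%classic t| <= C) ->
  `|partial_multi alpha (cube_cutoff r d) x| <= (3 * C) ^+ n * d^-1 ^+ m.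
Proof.
move=> C1 hC.
rewrite (partial_multi_tensor _ _ _ (is_derive_cutoff R r d)).
rewrite normr_prod.
apply: (@le_trans _ _ (\prod_(i < n) (3 * C * d^-1 ^+ val alpha i))).
  apply: ler_prod => i _; rewrite normr_ge0/=; apply: cutoff_bounded => //.
  by apply: hC; rewrite -ltnS.
rewrite big_split/= prodr_const card_ord -expr_sum.
by have /eqP -> := valP alpha.
Qed.

Lemma cube_cutoff_ge0 x : 0 <= cube_cutoff r d x.
Proof. by apply: prodr_ge0 => i _; exact: cutoff0_ge0. Qed.

Lemma cube_cutoff_eq1 x : cube r x -> cube_cutoff r d x = 1.
Proof.
by move=> /cubeP xr; rewrite /cube_cutoff /tensor big1// => i _;
exact: cutoff0_eq1.
Qed.

Lemma test_function_cube_cutoff : test_function (cube_cutoff r d).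
Proof.
split; first by exact: smooth_tensor (is_derive_cutoff R r d) _.
apply: (subclosed_compact (@closed_closure _ _) (@compact_cube (r + d))).
rewrite [X in _ `<=` X](closure_id _).1; last first.
  by apply: compact_closed; [exact: norm_hausdorff|exact: compact_cube].
apply: closureS => x /= phi0; apply/cubeP => i.
rewrite leNgt; apply/negP => xi; move/eqP: phi0; apply.
by rewrite /cube_cutoff /tensor (bigD1 i)//= cutoff_eq0// mul0r.
Qed.

End cube_cutoff_theory.
End cube.

(** * The energy estimate *)

Section energy.
Variables (R : realType) (m n : nat) (a : multi_index n m -> 'rV[R]_n -> R -> R).
Variables (A : R) (g : R -> R) (u : 'rV[R]_n -> R).
Hypothesis A0 : 0 < A.
Hypothesis a_bound : forall alpha,
  {ae @lebesgue_rV R n, forall x, forall z, `|a alpha x z| <= A * `|z|}.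
Hypothesis g0 : forall z, 0 <= z -> 0 <= g z.
Hypothesis solution : global_weak_solution a g u.

Local Notation mu := (@lebesgue_rV R n).

Lemma measurable_abs_solution : measurable_fun [set: lebesgueType R n]
  (fun x => (`|u x|)%:E).
Proof.
have [[mu_ _] _ _] := solution.
by apply/measurable_EFinP; apply: measurableT_comp.
Qed.

(** Testing the inequality with the cutoff of a cube: on the left the cutoff is
at least the indicator of the small cube, on the right every flux is at most
A |u| and every derivative of order m is at most a constant times d^(-m) and
vanishes off the large cube. *)
Lemma energy_estimate : exists2 K, 0 < K & forall r d, 0 <= r -> 0 < d ->
  (\int[mu]_(x in cube R n r) (g `|u x|)%:E <=
   (K * d^-1 ^+ m)%:E * \int[mu]_(x in cube R n (r + d)) (`|u x|)%:E)%E.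
Proof.
have [C C1 hC] := derive1n_step_uniformly_bounded R m.
have C0 : 0 < C by exact: lt_le_trans C1.
pose B := (3 * C) ^+ n.
have B0 : 0 < B by rewrite exprn_gt0// mulr_gt0.
pose N := #|{: multi_index n m}|.
(* The successor of N, the number of multi-indices, only serves to have a
   positive constant. *)
exists (N.+1%:R * (A * B)); first by rewrite !mulr_gt0.
move=> r d r0 d0; set k := _ * d^-1 ^+ m.
have dm0 : 0 <= d^-1 ^+ m by rewrite exprn_ge0// invr_ge0 ltW.
have k0 : 0 <= k by rewrite !mulr_ge0// ltW.
have [_ _ /(_ _ (test_function_cube_cutoff R n r d r0 d0)
  (cube_cutoff_ge0 R n r d r0 d0))] := solution.
set phi := cube_cutoff R n r d => sol.
rewrite integral_mkcond; apply: le_trans (le_trans sol _).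
  apply: ge0_le_integral_nomeas => x.
    by apply: erestrict_ge0 => y _; rewrite lee_fin g0.
  rewrite patchE; case: ifPn => [/set_mem xr|_].
    by rewrite /phi cube_cutoff_eq1// mulr1.
  by rewrite lee_fin mulr_ge0 ?g0// cube_cutoff_ge0.
have mQ := measurable_cube R n (r + d).
have mkU : measurable_fun (cube R n (r + d) : set (lebesgueType R n))
    (fun x => (k%:E * (`|u x|)%:E)%E).
  apply: measurable_funeM; apply: measurable_funTS.
  exact: measurable_abs_solution.
rewrite -(@ge0_integralZl_EFin _ _ _ mu _ mQ (fun x => (`|u x|)%:E) _ _ k k0);
  first last.
- by apply: measurable_funTS; exact: measurable_abs_solution.
- by move=> x _; rewrite lee_fin.
rewrite [leRHS]integral_mkcond; apply: ae_le_integral_nomeas.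
- exact/(measurable_restrictT _ _).1.
- by apply: erestrict_ge0 => x _; rewrite -EFinM lee_fin mulr_ge0.
have : {ae mu, forall x, forall alpha z, `|a alpha x z| <= A * `|z|}.
  exact: filter_forall.
apply: (@filterS _ _ (ae_filter_ringOfSetsType mu)) => x ax.
rewrite patchE; case: ifPn => [_|/negP xr].
  rewrite -EFinM lee_fin (le_trans (ler_norm _))//.
  apply: (le_trans (ler_norm_sum _ _ _)).
  apply: (@le_trans _ _
    (\sum_(alpha : multi_index n m) A * B * d^-1 ^+ m * `|u x|)).
    apply: ler_sum => alpha _; rewrite !normrM normrX normrN1 expr1n mul1r.
    rewrite (_ : A * B * _ * _ = A * `|u x| * (B * d^-1 ^+ m)); last by ring.
    by rewrite ler_pM//; exact: partial_cube_cutoff_bounded.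
  rewrite sumr_const -/N -mulr_natl /k !mulrA ler_wpM2r// ler_wpM2r//.
  by rewrite ler_wpM2r ?ler_wpM2r ?ler_nat ?ltW.
rewrite big1 ?lexx// => alpha _.
rewrite partial_cube_cutoff_eq0 ?mulr0// => xrd; apply: xr.
exact: mem_set.
Qed.

End energy.

(** * A Jensen inequality without supporting lines *)

Section convex_profile.
Variables (R : realType) (g : R -> R).
Hypothesis g_nondecreasing : {in `[0, +oo[ &, {homo g : x y / x <= y}}.
Hypothesis g_convex : @convex_function R R^o `[0, +oo[ g.

Lemma nondecreasing_ge0 s t : 0 <= s -> s <= t -> g s <= g t.
Proof.
move=> s0 st; apply: g_nondecreasing => //; rewrite in_itv/= andbT//.
exact: le_trans st.
Qed.

Lemma convex_chord0 s t : 0 <= s -> s <= t -> 0 < t ->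
  g s <= s / t * g t + (1 - s / t) * g 0.
Proof.
move=> s0 st t0.
have p0 : 0 <= s / t by rewrite divr_ge0// ltW.
have p1 : s / t <= 1 by rewrite ler_pdivrMr// mul1r.
have tD : t \in `[0, +oo[%classic by rewrite inE/= in_itv/= andbT ltW.
have zD : (0 : R) \in `[0, +oo[%classic by rewrite inE/= in_itv/= andbT.
have : g (s / t * t + (1 - s / t) * 0) <= s / t * g t + (1 - s / t) * g 0.
  exact: (g_convex (Itv01 p0 p1) t 0 tD zD).
by rewrite mulr0 addr0 divfK ?gt_eqF.
Qed.

(** Jensen's inequality at half the mean, which is enough for the present
purposes and needs no one-sided derivatives of g. With s half the mean of f,
convexity along the chord from 0 gives g(t) >= g(0) + (g(s) - g(0)) (t/s - 1)
for all t >= 0: for t <= s by monotonicity, for t >= s since g(t) is above the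
prolonged chord. The mean of t/s - 1 over t = f(x) is exactly 1. *)
Lemma convex_half_mean d (T : measurableType d) (mu : {measure set T -> \bar R})
    (D : set T) (V : R) (f : T -> R) :
  measurable D -> mu D = V%:E -> 0 < V -> (forall x, 0 <= f x) ->
  mu.-integrable D (EFin \o f) -> mu.-integrable D (EFin \o (g \o f)) ->
  V * g ((\int[mu]_(x in D) f x) / (2 * V)) <= \int[mu]_(x in D) g (f x).
Proof.
move=> mD muD V0 f0 intf intgf.
set I := \int[mu]_(x in D) f x.
have I0 : 0 <= I.
  by rewrite fine_ge0//; apply: integral_ge0 => x _; rewrite lee_fin.
have intc c : mu.-integrable D (EFin \o (fun=> c)).
  apply/integrableP; split; first exact: measurable_cst.
  by rewrite integral_cst//= muD -EFinM ltry.
pose s := I / (2 * V).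
have s0 : 0 <= s by rewrite divr_ge0// mulr_ge0// ltW.
have [sE|sN0] := eqVneq s 0.
  rewrite -/s sE mulrC -[V](_ : fine (mu D) = V); last by rewrite muD.
  rewrite -(Rintegral_cst mu mD); apply: le_Rintegral => // x _.
  exact: nondecreasing_ge0.
have sgt0 : 0 < s by rewrite lt_neqAle eq_sym sN0.
pose k := (g s - g 0) / s.
have k0 : 0 <= k by rewrite divr_ge0// subr_ge0 nondecreasing_ge0.
have gk x : 2 * g 0 - g s + k * f x <= g (f x).
  have [fs|sf] := leP (f x) s.
    apply: le_trans (nondecreasing_ge0 _ _ (lexx 0) (f0 x)).
    have : k * f x <= k * s by rewrite ler_wpM2l.
    by rewrite /k divfK ?gt_eqF//; lra.
  have fx0 : 0 < f x by exact: lt_trans sf.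
  have := convex_chord0 _ _ s0 (ltW sf) fx0 => h.
  have {}h : g s - g 0 <= s / f x * (g (f x) - g 0) by lra.
  have kf : k * f x <= g (f x) - g 0.
    rewrite (_ : k * f x = f x / s * (g s - g 0)); last by rewrite /k; ring.
    rewrite (_ : g (f x) - g 0 = f x / s * (s / f x * (g (f x) - g 0))).
      by rewrite ler_wpM2l// divr_ge0// ltW.
    by field; rewrite !gt_eqF.
  have := nondecreasing_ge0 _ _ (lexx 0) s0; lra.
have intkf : mu.-integrable D (EFin \o (fun x => k * f x)).
  by apply: (integrableZl mD k intf).
apply: (@le_trans _ _ (\int[mu]_(x in D) (2 * g 0 - g s + k * f x))).
  rewrite (RintegralD mD (intc _) intkf) (Rintegral_cst mu mD) muD/=.
  rewrite (RintegralZl _ mD intf) -/I -/s.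
  have -> : I = 2 * V * s by rewrite /s mulrC divfK// mulf_neq0 ?gt_eqF.
  by rewrite mulrCA (mulrC k) mulrA -(mulrA _ s) (mulrC s) /k divfK ?gt_eqF//; lra.
apply: le_Rintegral => //.
exact: (integrableD mD (intc _) intkf).
Qed.

End convex_profile.

(** * The Keller-Osserman iteration *)

Section keller_osserman.
Variables (R : realType) (m : nat) (g : R -> R).
Hypothesis m0 : (0 < m)%N.
Hypothesis g_nondecreasing : {in `[0, +oo[ &, {homo g : x y / x <= y}}.
Hypothesis g_convex : @convex_function R R^o `[0, +oo[ g.
Hypothesis g_gt0 : forall z : R, 0 < z -> 0 < g z.

Local Notation mu := (@lebesgue_measure R).
Local Notation p := (m%:R^-1 : R).

Definition osserman_density (z : R) : R := g z `^ (- p) * z `^ (p - 1).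

Hypothesis g_int :
  (\int[mu]_(z in `]0%R, +oo[) (osserman_density z)%:E < +oo)%E.

Definition osserman_integral (s : R) : R :=
  \int[mu]_(z in `]0%R, s]) osserman_density z.

(** Up to a constant, the distance over which a function subject to the energy
estimate must double its value s. *)
Definition time_scale (s : R) : R := (s / g s) `^ p.

Let p_gt0 : 0 < p. Proof. by rewrite invr_gt0 ltr0n. Qed.
Let p_le1 : p <= 1. Proof. by rewrite invf_le1 ?ltr0n// ler1n. Qed.

Lemma osserman_density_ge0 z : 0 <= osserman_density z.
Proof. by rewrite mulr_ge0 ?powR_ge0. Qed.

Lemma osserman_density_nonincreasing s t : 0 < s -> s <= t ->
  osserman_density t <= osserman_density s.
Proof.
move=> s0 st; have t0 : 0 < t by exact: lt_le_trans st.
have gst := nondecreasing_ge0 _ _ g_nondecreasing _ _ (ltW s0) st.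
have [gs0 gt0] := (g_gt0 _ s0, g_gt0 _ t0).
rewrite /osserman_density -(opprB 1 p) !powRN -!invfM lef_pV2.
- rewrite ler_pM ?powR_ge0//; apply: ge0_ler_powR => //.
  + by rewrite nnegrE ltW.
  + by rewrite nnegrE ltW.
  + by rewrite subr_ge0.
  + by rewrite nnegrE ltW.
  + by rewrite nnegrE ltW.
- by rewrite posrE mulr_gt0 ?powR_gt0.
- by rewrite posrE mulr_gt0 ?powR_gt0.
Qed.

Lemma mul_osserman_density s : 0 < s -> s * osserman_density s = time_scale s.
Proof.
move=> s0; have gs := g_gt0 _ s0.
have sE : s * s `^ (p - 1) = s `^ p.
  rewrite -[X in X * _](powRr1 (ltW s0)) -powRD.
    by rewrite addrC subrK.
  by apply/implyP => _; rewrite gt_eqF.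
rewrite /osserman_density /time_scale mulrCA sE powRM ?invr_ge0 ?ltW// mulrC.
by rewrite -[(g s)^-1](powR_inv1 (ltW gs)) -powRrM mulN1r.
Qed.

Lemma time_scaleX s : 0 < s -> time_scale s ^+ m = s / g s.
Proof.
move=> s0; rewrite -powR_mulrn ?powR_ge0// -powRrM mulVf ?powRr1//.
  by rewrite divr_ge0// ltW// g_gt0.
by rewrite pnatr_eq0 -lt0n.
Qed.

Lemma integrable_osserman_density :
  mu.-integrable `]0%R, +oo[ (EFin \o osserman_density).
Proof.
apply/integrableP; split; last first.
  by under eq_integral do rewrite /= ger0_norm ?osserman_density_ge0//.
(* g is monotone on the half-line only; G is a monotone extension of it. *)
pose G z := g (Num.max 0 z).
have mG : measurable_fun [set: R] G.
  apply: nondecreasing_measurable => // x y xy; apply: g_nondecreasing.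
  - by rewrite in_itv/= andbT le_max lexx.
  - by rewrite in_itv/= andbT le_max lexx.
  - by rewrite ge_max !le_max lexx xy/= orbT.
apply/measurable_EFinP.
apply: (@eq_measurable_fun _ _ _ _ _ (fun z => G z `^ (- p) * z `^ (p - 1))).
  move=> z; rewrite inE/= in_itv/= andbT => z0.
  by rewrite /G max_r// ltW.
apply: measurable_funTS; apply: measurable_funM; last exact: measurable_powR.
exact: (measurableT_comp (measurable_powR _)).
Qed.

Lemma integrable_osserman_density_sub (D : set R) : measurable D ->
  D `<=` `]0%R, +oo[ -> mu.-integrable D (EFin \o osserman_density).
Proof. by move=> mD D0; exact: integrableS integrable_osserman_density. Qed.

Lemma osserman_integral_le (D E : set R) : measurable D -> measurable E ->
  D `<=` E -> E `<=` `]0%R, +oo[ ->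
  \int[mu]_(z in D) osserman_density z <= \int[mu]_(z in E) osserman_density z.
Proof.
move=> mD mE DE E0; have intE := integrable_osserman_density_sub _ mE E0.
apply: fine_le.
- apply: integrable_fin_num => //.
  exact: integrable_osserman_density_sub (subset_trans DE E0).
- exact: integrable_fin_num.
- apply: ge0_subset_integral => //; first exact: measurable_int intE.
  by move=> x _; rewrite lee_fin osserman_density_ge0.
Qed.

Lemma osserman_integral_ge0 s : 0 <= osserman_integral s.
Proof.
rewrite fine_ge0//; apply: integral_ge0 => x _; rewrite lee_fin.
exact: osserman_density_ge0.
Qed.

(** The density is nonincreasing, so that its integral over ]s/2, s] is at least
s/2 times its value at s. A doubling of the value s is thus paid for by the
piece ]s/2, s] of the convergent integral. *)
Lemma osserman_integral_step s : 0 < s ->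
  osserman_integral (s / 2) + time_scale s / 2 <= osserman_integral s.
Proof.
move=> s0; have s20 : 0 < s / 2 by rewrite divr_gt0.
have s2s : s / 2 <= s by lra.
have sub : `]s / 2, s] `<=` `]0%R, +oo[.
  by apply: subset_itv; rewrite bnd_simp// ltW.
have sub0 : `]0%R, s] `<=` `]0%R, +oo[ by apply: subset_itv; rewrite bnd_simp.
have splitE : `]0%R, s]%classic = `]0%R, s / 2] `|` `]s / 2, s].
  by rewrite -itv_bndbnd_setU// bnd_simp// ltW.
rewrite /osserman_integral splitE Rintegral_setU//; last 2 first.
- by rewrite -splitE; exact: integrable_osserman_density_sub sub0.
- by apply/disj_set2P; rewrite -subset0 => x /=; rewrite !in_itv/=; lra.
rewrite lerD2l -mul_osserman_density//.
have -> : s * osserman_density s / 2 = osserman_density s * fine (mu `]s / 2, s]).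
  rewrite lebesgue_measure_itv/= lte_fin ifT; last by lra.
  by rewrite /=; field.
rewrite -(Rintegral_cst mu (measurable_itv _)); apply: le_Rintegral => //.
- apply/integrableP; split; first exact: measurable_cst.
  rewrite integral_cst//= lebesgue_measure_itv/= lte_fin ifT; last by lra.
  by rewrite -EFinM ltry.
- exact: integrable_osserman_density_sub sub.
- move=> x /=; rewrite in_itv/= => /andP[x0 xs].
  by apply: osserman_density_nonincreasing => //; exact: lt_trans x0.
Qed.

Lemma osserman_integral_nondecreasing s t : s <= t ->
  osserman_integral s <= osserman_integral t.
Proof.
move=> st; apply: osserman_integral_le => //.
  by apply: subset_itv; rewrite bnd_simp.
by apply: subset_itv; rewrite bnd_simp.
Qed.

(** If g(0) <= 0 then g grows at most linearly near 0 by convexity, and the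
density is at least a multiple of 1/z: each dyadic piece ]s/2, s] adds the
same amount to the integral, which diverges at the origin. *)
Lemma osserman_profile_gt0 : 0 < g 0.
Proof.
rewrite ltNge; apply/negP => g00.
pose c := (g 1)^-1 `^ p.
have g1 : 0 < g 1 by exact: g_gt0.
have c0 : 0 < c by rewrite powR_gt0// invr_gt0.
have c_le s : 0 < s -> s <= 1 -> c <= time_scale s.
  move=> s0 s1; have gs := g_gt0 _ s0.
  have := convex_chord0 _ _ g_convex _ _ (ltW s0) s1 ltr01; rewrite divr1 => h.
  have {}h : g s <= s * g 1.
    by rewrite (le_trans h)// gerDl mulr_ge0_le0// subr_ge0.
  rewrite /c /time_scale; apply: ge0_ler_powR.
  - exact: ltW.
  - by rewrite nnegrE invr_ge0 ltW.
  - by rewrite nnegrE divr_ge0// ltW.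
  - by rewrite ler_pdivlMr// mulrC ler_pdivrMr.
have lower k :
    k%:R * (c / 2) + osserman_integral (2^-1 ^+ k) <= osserman_integral 1.
  elim: k => [|k IH]; first by rewrite mul0r add0r expr0.
  have k0 : 0 < 2^-1 ^+ k :> R by rewrite exprn_gt0// invr_gt0.
  have k1 : 2^-1 ^+ k <= 1 :> R by rewrite exprn_ile1 ?invr_ge0// invf_le1// ler1n.
  have := osserman_integral_step _ k0; have := c_le _ k0 k1.
  by rewrite exprSr -[k.+1%:R]natr1 (mulrDl k%:R) mul1r; lra.
have c2 : 0 < c / 2 by rewrite divr_gt0.
have [k hk] : exists k : nat, osserman_integral 1 < k%:R * (c / 2).
  exists (Num.truncn (osserman_integral 1 / (c / 2))).+1.
  by rewrite -ltr_pdivrMr// truncnS_gt.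
have := lower k; have := osserman_integral_ge0 (2^-1 ^+ k); lra.
Qed.

Definition osserman_total : R := \int[mu]_(z in `]0%R, +oo[) osserman_density z.

Lemma osserman_integral_le_total s : osserman_integral s <= osserman_total.
Proof.
by apply: osserman_integral_le => //; apply: subset_itv; rewrite bnd_simp.
Qed.

(** Advance from r by the step d for which the hypothesis reads
2 w(r) <= w(r + d). The steps add up to at most a multiple of the integrals of
the density over the pairwise disjoint intervals ]w/2, w]. If rho exceeded the
bound, so would it exceed this sum, and w could be doubled forever inside the
bounded interval [rho, 2 rho]. *)
Lemma growth_blows_up (w : R -> R) (K rho : R) : 0 < K -> 0 < w rho ->
  {in `[rho, 2 * rho] &, {homo w : r t / r <= t}} ->
  (forall r d, rho <= r -> 0 < d -> r + d <= 2 * rho ->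
    g (w r) <= K * d^-1 ^+ m * w (r + d)) ->
  rho < 2 * (2 * K) `^ p * osserman_total.
Proof.
move=> K0 w0 w_nd growth; rewrite ltNge; apply/negP.
set e := (2 * K) `^ p => rho_large.
have e0 : 0 < e by rewrite powR_gt0// mulr_gt0.
have eX : e ^+ m = 2 * K.
  rewrite -powR_mulrn ?powR_ge0// -powRrM mulVf ?powRr1 ?pnatr_eq0 -?lt0n//.
  by rewrite mulr_ge0// ltW.
(* r - rho is controlled by the integral up to half the current value: the
   other half is what the next step consumes. *)
have climb k : exists r, [/\ rho <= r,
    r - rho <= 2 * e * osserman_integral (w r / 2) & 2 ^+ k * w rho <= w r].
  elim: k => [|k [r [rho_r r_le wr]]].
    exists rho; split => //; last by rewrite expr0 mul1r.
    by rewrite subrr !mulr_ge0 ?osserman_integral_ge0// ltW.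
  have wr0 : 0 < w r by rewrite (lt_le_trans _ wr)// mulr_gt0// exprn_gt0.
  have gw0 := g_gt0 _ wr0.
  pose d := e * time_scale (w r).
  have d0 : 0 < d by rewrite mulr_gt0// powR_gt0// divr_gt0.
  have rd_le : r + d - rho <= 2 * e * osserman_integral (w r).
    have := ler_wpM2l (ltW e0) (osserman_integral_step _ wr0).
    by rewrite /d mulrDr; lra.
  have rd_in : r + d <= 2 * rho.
    have : 2 * e * osserman_integral (w r) <= 2 * e * osserman_total.
      by rewrite ler_wpM2l ?osserman_integral_le_total// mulr_ge0// ltW.
    by lra.
  have w2 : 2 * w r <= w (r + d).
    have := growth _ _ rho_r d0 rd_in.
    rewrite exprVn exprMn eX time_scaleX// => h.
    have -> : w (r + d) = 2 * w r / g (w r) *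
        (K * (2 * K * (w r / g (w r)))^-1 * w (r + d)).
      by field; rewrite !gt_eqF.
    by rewrite mulrAC ler_pdivlMr// ler_wpM2l// mulr_ge0// ltW.
  exists (r + d); split.
  - by rewrite (le_trans rho_r)// lerDl ltW.
  - apply: (le_trans rd_le); rewrite ler_wpM2l//; first by rewrite mulr_ge0// ltW.
    by apply: osserman_integral_nondecreasing; lra.
  - by rewrite exprS -mulrA (le_trans _ w2)// ler_wpM2l.
have [k hk] : exists k : nat, w (2 * rho) < 2 ^+ k * w rho.
  exists (Num.truncn (w (2 * rho) / w rho)).+1.
  rewrite -ltr_pdivrMr// (lt_trans (truncnS_gt _))//.
  by rewrite -natrX ltr_nat ltn_expl.
have [r [rho_r r_le wr]] := climb k.
have r2 : r <= 2 * rho.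
  have : 2 * e * osserman_integral (w r / 2) <= 2 * e * osserman_total.
    by rewrite ler_wpM2l ?osserman_integral_le_total// mulr_ge0// ltW.
  by lra.
have : w r <= w (2 * rho).
  by apply: w_nd; rewrite ?in_itv/=; lra.
lra.
Qed.

(** On [rho, 2 rho] the volumes of the cubes are comparable, so that dividing U
by a fixed volume brings the growth condition into the form used by
[growth_blows_up], with a constant that does not depend on rho. *)
Lemma mean_growth_contradiction (n : nat) (K : R) (U : R -> R) : 0 < K ->
  (forall r, 0 <= U r) -> {homo U : r t / r <= t} ->
  (forall r d, 0 < r -> 0 < d ->
    (2 * r) ^+ n * g (U r / (2 * (2 * r) ^+ n)) <= K * d^-1 ^+ m * U (r + d)) ->
  False.
Proof.
move=> K0 U0 U_nd growth.
have V0 (r : R) : 0 < r -> 0 < (2 * r) ^+ n.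
  by move=> r0; rewrite exprn_gt0// mulr_gt0.
have g0 z : 0 <= z -> 0 < g z.
  move=> z0; apply: (lt_le_trans osserman_profile_gt0).
  exact: nondecreasing_ge0.
(* The left-hand side of the growth condition is positive as g(0) > 0 and g is
   monotone; this excludes the solution u = 0. *)
have U2 : 0 < U 2.
  have := growth 1 1 ltr01 ltr01; rewrite invr1 expr1n !mulr1 => h.
  rewrite -(pmulr_rgt0 _ K0); apply: lt_le_trans h.
  by rewrite mulr_gt0 ?exprn_gt0 ?g0// divr_ge0// mulr_ge0// exprn_ge0.
pose K1 := K * (2 * 2 ^+ n).
have K10 : 0 < K1 by rewrite !mulr_gt0// exprn_gt0.
(* rho is beyond the bound that growth_blows_up puts on it. *)
pose rho := Num.max 2 (2 * (2 * K1) `^ p * osserman_total).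
have rho2 : 2 <= rho by rewrite le_max lexx.
have rho0 : 0 < rho by exact: lt_le_trans rho2.
pose V := (2 * (2 * rho)) ^+ n.
have V_gt0 : 0 < V by rewrite V0// mulr_gt0.
have V2_gt0 : 0 < 2 * V by rewrite mulr_gt0.
have VE : V = 2 ^+ n * (2 * rho) ^+ n by rewrite /V exprMn.
pose w r := U r / (2 * V).
suff : rho < 2 * (2 * K1) `^ p * osserman_total.
  by rewrite ltNge le_max lexx orbT.
apply: (growth_blows_up w) => //.
- by rewrite divr_gt0// (lt_le_trans U2)// U_nd.
- by move=> r t _ _ rt; rewrite ler_wpM2r ?U_nd// invr_ge0 ltW.
move=> r d rho_r d0 rd; have r0 : 0 < r by exact: lt_le_trans rho_r.
have Vr := V0 _ r0; have Vrho := V0 _ rho0.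
have VrV : (2 * r) ^+ n <= V.
  by apply: lerXn2r; rewrite ?nnegrE; lra.
have w_le : w r <= U r / (2 * (2 * r) ^+ n).
  by rewrite ler_wpM2l// lef_pV2 ?posrE ?ler_wpM2l// mulr_gt0.
have wr0 : 0 <= w r by rewrite divr_ge0// ltW.
have gw : g (w r) <= g (U r / (2 * (2 * r) ^+ n)) by exact: nondecreasing_ge0.
have VrhoVr : (2 * rho) ^+ n <= (2 * r) ^+ n.
  by apply: lerXn2r; rewrite ?nnegrE; lra.
have : (2 * rho) ^+ n * g (w r) <= K * d^-1 ^+ m * U (r + d).
  apply: le_trans (growth _ _ r0 d0); apply: ler_pM => //; first exact: ltW.
  by rewrite ltW// g0.
have -> : U (r + d) = 2 * V * w (r + d) by rewrite /w mulrC divfK ?gt_eqF.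
rewrite VE mulrC -ler_pdivlMr// => /le_trans; apply.
rewrite le_eqVlt; apply/orP; left; apply/eqP; rewrite /K1.
have : (2 * rho) ^+ n != 0 by rewrite gt_eqF.
by move: ((2 * rho) ^+ n) => X X0; field.
Qed.

End keller_osserman.

(** * Nonexistence of global weak solutions *)

Theorem theorem2p2 (R : realType) (m n : nat) (hm : (0 < m)%N) (hn : (0 < n)%N)
    (a : multi_index n m -> 'rV[R]_n -> R -> R)
    (a_caratheodory : forall alpha, caratheodory_function (a alpha))
    (A : R) (hA : 0 < A)
    (a_bound : forall alpha,
      {ae @lebesgue_rV R n, forall x, forall z, `|a alpha x z| <= A * `|z|})
    (g : R -> R)
    (g_nondecreasing : {in `[0, +oo[ &, {homo g : x y / x <= y}})
    (g_convex : @convex_function R R^o `[0, +oo[ g)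
    (g_gt0 : forall z : R, 0 < z -> 0 < g z)
    (g_int : (\int[lebesgue_measure]_(z in `]0%R, +oo[)
                (g z `^ (- m%:R^-1) * z `^ (m%:R^-1 - 1))%:E < +oo)%E) :
  ~ exists u : 'rV[R]_n -> R, global_weak_solution a g u.
Proof.
move=> [u solution].
have g_ge0 z : 0 <= z -> 0 <= g z.
  move=> z0; apply: le_trans (nondecreasing_ge0 _ _ g_nondecreasing _ _ (lexx 0) z0).
  exact: ltW (osserman_profile_gt0 _ _ _ hm g_nondecreasing g_convex g_gt0 g_int).
have [K K0 energy] := energy_estimate _ _ _ _ _ _ _ hA a_bound g_ge0 solution.
have [[_ int_u] [_ int_gu] _] := solution.
have mQ := measurable_cube R n; have cQ := compact_cube R n.
have int_absu r : (@lebesgue_rV R n).-integrable (cube R n r)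
    (EFin \o (fun x => `|u x|)).
  exact: integrable_abse (int_u _ (cQ r)).
pose U r := \int[@lebesgue_rV R n]_(x in cube R n r) `|u x|.
apply: (mean_growth_contradiction _ _ _ hm g_nondecreasing g_convex g_gt0 g_int
  n K U K0).
- move=> r; rewrite fine_ge0//; apply: integral_ge0 => x _.
  by rewrite lee_fin.
- move=> r t rt; apply: fine_le; try exact: integrable_fin_num.
  apply: (@ge0_subset_integral _ _ _ _ _ _ (mQ r) (mQ t)).
  + exact: measurable_int (int_absu t).
  + by move=> x _; rewrite lee_fin.
  + by rewrite -(subrK r t) addrC; apply: subset_cube; rewrite subr_ge0.
move=> r d r0 d0.
have muQ := lebesgue_cube R n r (ltW r0).
have V0 : 0 < (2 * r) ^+ n by rewrite exprn_gt0// mulr_gt0.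
have mean := @convex_half_mean R g g_nondecreasing g_convex _ _
  (@lebesgue_rV R n) (cube R n r) _ (fun x => `|u x|) (mQ r) muQ V0
  (fun x => normr_ge0 (u x)) (int_absu r) (int_gu _ (cQ r)).
apply: (le_trans mean).
have := energy r d (ltW r0) d0.
rewrite -(fineK (integrable_fin_num (mQ r) (int_gu _ (cQ r)))).
rewrite -(fineK (integrable_fin_num (mQ (r + d)) (int_absu (r + d)))).
by rewrite -EFinM lee_fin.
Qed.
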